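(* Let $i\in\{1,2\}$, let $W\in\mathbf{R}^{n\times n}$ be symmetric positive definite, let $\rho_k^i$ ($k=0,\dots,\nu$) be real constants with $\rho_k^i\ge\|\Pi_{ki}\|_i^2$, and let $f\in\mathbb{E}_0^n$. Suppose that the symmetric block matrix $$\Psi^i=\begin{bmatrix} Z_{00}^i&\cdots&Z_{0\nu}^i&N_0^i\\ \vdots&\ddots&\vdots&\vdots\\ Z_{\nu0}^i&\cdots&Z_{\nu\nu}^i&N_\nu^i\\ (N_0^i)^T&\cdots&(N_\nu^i)^T&W\end{bmatrix},\qquad Z_{kl}^i\in\mathbf{R}^{M_2\times M_2},\ N_k^i\in\mathbf{R}^{M_2\times n},$$ satisfies $\Psi^i\ge0$ (positive semidefinite). Then for every $\chi_i\in\mathbf{R}^{M_2}$, $$\langle f_i,Wf_i\rangle_i\ \ge\ -\chi_i^T\Big(\sum_{k=0}^{\nu}\rho_k^iZ_{kk}^i\Big)\chi_i-\mathrm{He}\big(\chi_i^TN^i\underline{w}\big),$$ where $N^1=(N_0^1,\dots,N_\nu^1,0,\dots,0)\in\mathbf{R}^{M_2\times M_2}$ and $N^2=(0,\dots,0,N_0^2,\dots,N_\nu^2)\in\mathbf{R}^{M_2\times M_2}$ (each with $M_1$ zero columns).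
   Context: For $i=0,1,2$, $\mathbb{E}_i$ is a real inner product space (not assumed complete) of functions $\varphi:D_i\to\mathbf{R}$, $D_i\subset\mathbf{R}$, with inner product $\langle\cdot,\cdot\rangle_i$ and norm $\|\cdot\|_i$, containing the constant function $\Pi_{0i}\equiv1$ and such that: (P1) if $\varphi,\psi\in\mathbb{E}_i$ then $\varphi\psi\in\mathbb{E}_i$ and $\langle\varphi,\psi\rangle_i=\langle\Pi_{0i},\varphi\psi\rangle_i$; (P2) if $\varphi\in\mathbb{E}_i$ and $\varphi(t)\ge0$ for all $t\in D_i$, then $\langle\Pi_{0i},\varphi\rangle_i\ge0$. Moreover $D_1\cap D_2=\emptyset$, $D_1\cup D_2=D_0$, restrictions to $D_i$ ($i=1,2$) of elements of $\mathbb{E}_0$ belong to $\mathbb{E}_i$, and $\langle\varphi,\psi\rangle_0=\langle\varphi_1,\psi_1\rangle_1+\langle\varphi_2,\psi_2\rangle_2$, where the subscript $i$ on a function denotes its restriction to $D_i$. $\nu\ge0$ and $n\ge1$ are integers, and $\Pi_{0i},\Pi_{1i},\dots,\Pi_{\nu i}$ is an orthogonal system (of nonzero elements) in $\mathbb{E}_i$. $M_1=(\nu+1)n$, $M_2=2M_1$. For $f=(f^{(1)},\dots,f^{(n)})\in\mathbb{E}_0^n$, $f_i\in\mathbb{E}_i^n$ is its restriction to $D_i$; for a scalar function $\varphi\in\mathbb{E}_i$, $\langle f_i,\varphi\rangle_i\in\mathbf{R}^n$ is taken componentwise; and $\langle f_i,Wf_i\rangle_i=\sum_{a,b}W_{ab}\langle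 f_i^{(a)},f_i^{(b)}\rangle_i$. Define $\underline{w}^i=\mathrm{col}\{\langle f_i,\Pi_{0i}\rangle_i,\dots,\langle f_i,\Pi_{\nu i}\rangle_i\}\in\mathbf{R}^{M_1}$ ($i=1,2$) and $\underline{w}=\mathrm{col}\{\underline{w}^1,\underline{w}^2\}\in\mathbf{R}^{M_2}$. $\mathrm{He}(A)=A+A^T$ (so $\mathrm{He}(s)=2s$ for a scalar). *)

(* Defs.v *)
From HB Require Import structures.
From mathcomp Require Import all_boot all_order all_algebra.
From mathcomp Require Import sesquilinear.
From mathcomp Require Import boolp classical_sets functions reals.

Set Implicit Arguments.
Unset Strict Implicit.
Unset Printing Implicit Defensive.

Import Order.TTheory GRing.Theory Num.Theory.
Local Open Scope classical_set_scope.
Local Open Scope ring_scope.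

Section Subspace.
Variables (R : realType) (V : lmodType R) (S : submodClosed V).

Record subspace := Subspace { subspace_val : V; _ : subspace_val \in S }.

HB.instance Definition _ := [isSub for subspace_val].
HB.instance Definition _ := [Choice of subspace by <:].
HB.instance Definition _ := [SubChoice_isSubLmodule of subspace by <:].

End Subspace.

(* Inner product spaces of functions D -> R, with no completeness required.
   The codomain is written R^o so that D -> R^o carries the pointwise vector
   space structure over R; 1 and * on D -> R^o are the constant function 1 and
   the pointwise product. *)
Record funIP (R : realType) (D : set R) := FunIP {
  fun_space :> submodClosed (D -> R^o);
  ip : {dot (subspace fun_space) for idfun};
  fun_space1 : (1 : D -> R^o) \in fun_space;
  fun_spaceM : forall phi psi : subspace fun_space,
    (val phi * val psi : D -> R^o) \in fun_space;
  ip_mul : forall phi psi : subspace fun_space,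
    ip phi psi = ip (Subspace fun_space1) (Subspace (fun_spaceM phi psi));
  ip_ge0 : forall phi : subspace fun_space,
    (forall t : D, 0 <= val phi t) -> 0 <= ip (Subspace fun_space1) phi
}.
Arguments ip {R D} _.
Arguments fun_space1 {R D} _.
Arguments fun_spaceM {R D} _.

Section FunIPTheory.
Variables (R : realType) (D : set R) (E : funIP D).

Definition const1 : subspace E := Subspace (fun_space1 E).

Definition ipnorm (phi : subspace E) : R := Num.sqrt (ip E phi phi).

Definition ip_col n (g : 'I_n -> subspace E) (phi : subspace E) : 'cV[R]_n :=
  \col_a ip E (g a) phi.

Definition ip_quad n (W : 'M[R]_n) (g : 'I_n -> subspace E) : R :=
  \sum_a \sum_b W a b * ip E (g a) (g b).

Definition orthogonal_system m (P : 'I_m -> subspace E) : Prop :=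
  (forall k, P k != 0) /\ (forall k l, k != l -> ip E (P k) (P l) = 0).

End FunIPTheory.

(* The index set {1, 2} of the two pieces of D_0. *)
Variant part := part1 | part2.

Section Restriction.
Variables (R : realType) (D0 : set R) (D : part -> set R).
Hypothesis cover : D part1 `|` D part2 = D0.

Lemma part_in (i : part) (t : D i) : val t \in D0.
Proof.
by case: t => t /= /set_mem Dit; rewrite inE -cover; case: i Dit => ?;
   [left|right].
Qed.

Definition restr_fun (i : part) (phi : D0 -> R^o) : D i -> R^o :=
  fun t => phi (exist _ (val t) (part_in t)).

Variables (E0 : funIP D0) (E : forall i, funIP (D i)).
Hypothesis stable :
  forall i (phi : subspace E0), restr_fun (i := i) (val phi) \in fun_space (E i).

Definition restr (i : part) (phi : subspace E0) : subspace (E i) := Subspace (stable i phi).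

End Restriction.

Definition posdefmx (R : realType) n (A : 'M[R]_n) : Prop :=
  A^T = A /\ forall x : 'cV[R]_n, x != 0 -> 0 < (x^T *m A *m x) 0 0.

Definition possemidefmx (R : realType) n (A : 'M[R]_n) : Prop :=
  A^T = A /\ forall x : 'cV[R]_n, 0 <= (x^T *m A *m x) 0 0.

Definition He (R : realType) n (A : 'M[R]_n) : 'M[R]_n := A + A^T.

(* The sum forms below are the dimensions of the library's block matrices;
   M1E and M2E give the closed forms. *)
Definition M1 (nu n : nat) : nat := (\sum_(k < nu.+1) n)%N.
Definition M2 (nu n : nat) : nat := (M1 nu n + M1 nu n)%N.

Lemma M1E nu n : M1 nu n = (nu.+1 * n)%N.
Proof. by rewrite /M1 sum_nat_const card_ord. Qed.

Lemma M2E nu n : M2 nu n = (2 * M1 nu n)%N.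
Proof. by rewrite /M2 mul2n addnn. Qed.

Section Blocks.
Variables (R : realType) (nu n : nat).
Variables (Z : 'I_nu.+1 -> 'I_nu.+1 -> 'M[R]_(M2 nu n)).
Variables (N : 'I_nu.+1 -> 'M[R]_(M2 nu n, n)).

Definition Psi (W : 'M[R]_n) : 'M[R]_(\sum_(k < nu.+1) M2 nu n + n) :=
  block_mx (\mxblock_(k < nu.+1, l < nu.+1) Z k l) (\mxcol_(k < nu.+1) N k)
           (\mxrow_(k < nu.+1) (N k)^T)            W.

Definition Nmx (i : part) : 'M[R]_(M2 nu n) :=
  match i with
  | part1 => row_mx (\mxrow_(k < nu.+1) N k) (0 : 'M[R]_(M2 nu n, M1 nu n))
  | part2 => row_mx (0 : 'M[R]_(M2 nu n, M1 nu n)) (\mxrow_(k < nu.+1) N k)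
  end.

End Blocks.

Definition wpart (R : realType) (D : set R) (E : funIP D) nu n
    (P : 'I_nu.+1 -> subspace E) (g : 'I_n -> subspace E) : 'cV[R]_(M1 nu n) :=
  \mxcol_(k < nu.+1) ip_col g (P k).

(* Main.v *)
Require Import Defs.
From HB Require Import structures.
From mathcomp Require Import all_boot all_order all_algebra.
From mathcomp Require Import sesquilinear.
From mathcomp Require Import boolp classical_sets functions reals.

Set Implicit Arguments.
Unset Strict Implicit.
Unset Printing Implicit Defensive.

Import Order.TTheory GRing.Theory Num.Theory.
Local Open Scope classical_set_scope.
Local Open Scope ring_scope.

(** By (P1) and (P2), the Gram matrix of any finite family in [E i] has a
    nonnegative pairing with every positive semidefinite matrix. Compressing
    [Psi] along [chi] gives a positive semidefinite matrix of size
    [nu + 1 + n], with diagonal entries [chi^T Z_kk chi >= 0], to be paired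
    with the family [Pi_0, ..., Pi_nu, f^(1), ..., f^(n)]: orthogonality kills
    the terms in [Z_kl] with [k <> l], and [rho_k] bounds the others. *)

Section QuadraticForms.
Variables (R : realType) (D : set R) (E : funIP D).

Lemma ip_sym (phi psi : subspace E) : ip E phi psi = ip E psi phi.
Proof. by rewrite (hermC (ip E)) expr0 mul1r. Qed.

Lemma ipnorm_sqr (phi : subspace E) : ipnorm phi ^+ 2 = ip E phi phi.
Proof.
rewrite sqr_sqrtr // ip_mul ip_ge0 // => t.
exact: (sqr_ge0 (val phi t : R)).
Qed.

(** (P1) rewrites the whole sum as the pairing of the constant 1 with the single function [q], the
    sum of the products [A a b * g a * g b]; (P2) then reduces the claim to a pointwise one. *)
Lemma ip_quad_ge0 m (A : 'M[R]_m) (g : 'I_m -> subspace E) :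
  possemidefmx A -> 0 <= ip_quad A g.
Proof.
move=> [_ A_ge0].
pose q : subspace E :=
  \sum_a \sum_b A a b *: (Subspace (fun_spaceM E (g a) (g b)) : subspace E).
have -> : ip_quad A g = ip E (const1 E) q.
  rewrite linear_sumr; apply: eq_bigr => a _.
  rewrite linear_sumr; apply: eq_bigr => b _.
  by rewrite linearZr_LR /= ip_mul.
(* At [t], [q] takes the value x^T A x, where x is the vector of values [g a] at [t]. *)
apply: ip_ge0 => t; have := A_ge0 (\col_a (val (g a) t : R)).
congr (0 <= _); rewrite /q raddf_sum fct_sumE.
rewrite mxE.
under [LHS]eq_bigr => b _ do rewrite !mxE mulr_suml.
rewrite exchange_big; apply: eq_bigr => a _.
rewrite raddf_sum fct_sumE; apply: eq_bigr => b _.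
by rewrite !mxE /= mulrAC mulrC.
Qed.
End QuadraticForms.

Lemma possemidefmx_congr (R : realType) m p (A : 'M[R]_m) (T : 'M[R]_(m, p)) :
  possemidefmx A -> possemidefmx (T^T *m A *m T).
Proof.
move=> [A_sym A_ge0]; split; first by rewrite !trmx_mul trmxK A_sym mulmxA.
by move=> x; have := A_ge0 (T *m x); rewrite trmx_mul !mulmxA.
Qed.

Lemma possemidefmx_diag (R : realType) m (A : 'M[R]_m) k :
  possemidefmx A -> 0 <= A k k.
Proof.
move=> [_ /(_ (delta_mx k 0))].
by rewrite trmx_delta -rowE -colE !mxE.
Qed.

(** Serves to place the scalar chi^T Z_kl chi at position (k, l) of the compressed matrix. *)
Lemma delta_mul11 (R : comPzRingType) m p (s : 'M[R]_1) (k : 'I_m) (l : 'I_p) :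
  delta_mx k 0 *m s *m delta_mx 0 l = s 0 0 *: delta_mx k l.
Proof.
by rewrite {1}[s]mx11_scalar mul_mx_scalar -scalemxAl mul_delta_mx.
Qed.

Section Compression.
Variables (R : realType) (nu n : nat) (chi : 'cV[R]_(M2 nu n)).

(* Block diagonal with all blocks [chi], i.e. [1 (x) chi]. *)
Definition compressor : 'M[R]_(\sum_(k < nu.+1) M2 nu n, nu.+1) :=
  \mxcol_(k < nu.+1) (chi *m delta_mx 0 k).

(** [T] maps (x, y) to the column with blocks x_k chi followed by y, so each Z_kl collapses to a
    scalar and each N_k to a row, while W is untouched. *)
Lemma Psi_compress (Z : 'I_nu.+1 -> 'I_nu.+1 -> 'M[R]_(M2 nu n))
    (N : 'I_nu.+1 -> 'M[R]_(M2 nu n, n)) (W : 'M[R]_n) :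
  let T := block_mx compressor 0 0 1%:M in
  T^T *m Psi Z N W *m T =
  block_mx (\matrix_(k, l) (chi^T *m Z k l *m chi) 0 0)
           (\matrix_(k, a) (chi^T *m N k) 0 a)
           (\matrix_(a, k) (chi^T *m N k) 0 a) W.
Proof.
rewrite /= tr_block_mx !mulmx_block !trmx0 trmx1 !mul0mx !mulmx0 !addr0 !add0r.
rewrite !mul1mx !mulmx1 /compressor tr_mxcol.
congr block_mx.
(* The three nontrivial blocks are compared as combinations of elementary matrices. *)
- rewrite mul_mxrow_mxblock mul_mxrow_mxcol [RHS]matrix_sum_delta exchange_big.
  apply: eq_bigr => l _; rewrite mulmx_suml; apply: eq_bigr => k _.
  by rewrite mxE -delta_mul11 trmx_mul trmx_delta !mulmxA.
- rewrite mul_mxrow_mxcol [RHS]matrix_sum_delta; apply: eq_bigr => k _.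
  rewrite trmx_mul trmx_delta -mulmxA [X in _ *m X]row_sum_delta mulmx_sumr.
  by apply: eq_bigr => a _; rewrite -scalemxAr mul_delta_mx [in RHS]mxE.
- rewrite mul_mxrow_mxcol [RHS]matrix_sum_delta exchange_big.
  apply: eq_bigr => k _; rewrite mulmxA [X in X *m _]matrix_sum_delta mulmx_suml.
  apply: eq_bigr => a _; rewrite big_ord1 -scalemxAl mul_delta_mx !mxE.
  by congr (_ *: _); apply: eq_bigr => j _; rewrite !mxE mulrC.
Qed.
End Compression.

(** Symmetry of the inner product makes [B] and [B^T] contribute equally, whence the factor 2 that
    becomes [He] in the theorem. *)
Lemma ip_quad_block (R : realType) (D : set R) (E : funIP D) m n
    (A : 'M[R]_m) (B : 'M[R]_(m, n)) (C : 'M[R]_n)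
    (g : 'I_m -> subspace E) (h : 'I_n -> subspace E) :
  ip_quad (block_mx A B B^T C)
    (fun a => match fintype.split a with inl k => g k | inr b => h b end) =
  ip_quad A g + (\sum_k \sum_b B k b * ip E (g k) (h b)) *+ 2 + ip_quad C h.
Proof.
rewrite /ip_quad big_split_ord /=.
have splitl k : fintype.split (lshift n k) = inl k by exact: (unsplitK (inl k)).
have splitr b : fintype.split (rshift m b) = inr b by exact: (unsplitK (inr b)).
under eq_bigr => k _.
  rewrite big_split_ord /=.
  under eq_bigr => l _ do rewrite block_mxEul !splitl.
  under [X in _ + X]eq_bigr => l _ do rewrite block_mxEur splitl splitr.
  over.
under [X in _ + X]eq_bigr => k _.
  rewrite big_split_ord /=.
  under eq_bigr => l _ do rewrite block_mxEdl splitl splitr ip_sym mxE.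
  under [X in _ + X]eq_bigr => l _ do rewrite block_mxEdr !splitr.
  over.
by rewrite !big_split /= [X in _ + (X + _)]exchange_big mulr2n !addrA.
Qed.

Lemma He11 (R : realType) (A : 'M[R]_1) : (He A) 0 0 = A 0 0 *+ 2.
Proof. by rewrite !mxE mulr2n. Qed.

Theorem lemma2 (R : realType) (D0 : set R) (D : part -> set R)
  (E0 : funIP D0) (E : forall i : part, funIP (D i))
  (disjoint : D part1 `&` D part2 = set0)
  (cover : D part1 `|` D part2 = D0)
  (stable : forall (i : part) (phi : subspace E0),
     restr_fun cover (i := i) (val phi) \in fun_space (E i))
  (ip_split : forall phi psi : subspace E0,
     ip E0 phi psi =
       ip (E part1) (restr stable part1 phi) (restr stable part1 psi) +
       ip (E part2) (restr stable part2 phi) (restr stable part2 psi))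
  (nu n : nat) (n_gt0 : (0 < n)%N)
  (Pi : forall i : part, 'I_nu.+1 -> subspace (E i))
  (Pi0 : forall i : part, Pi i ord0 = const1 (E i))
  (Pi_orth : forall i : part, orthogonal_system (Pi i))
  (i : part)
  (W : 'M[R]_n) (W_posdef : posdefmx W)
  (rho : 'I_nu.+1 -> R)
  (rho_ge : forall k, ipnorm (Pi i k) ^+ 2 <= rho k)
  (f : 'I_n -> subspace E0)
  (Z : 'I_nu.+1 -> 'I_nu.+1 -> 'M[R]_(M2 nu n))
  (N : 'I_nu.+1 -> 'M[R]_(M2 nu n, n))
  (Psi_ge0 : possemidefmx (Psi Z N W)) :
  let fr := fun (j : part) (a : 'I_n) => restr stable j (f a) in
  let w := col_mx (wpart (Pi part1) (fr part1)) (wpart (Pi part2) (fr part2)) in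
  forall chi : 'cV[R]_(M2 nu n),
    ip_quad W (fr i) >=
      - (chi^T *m (\sum_(k < nu.+1) rho k *: Z k k) *m chi) 0 0
      - (He (chi^T *m Nmx N i *m w)) 0 0.
Proof.
move=> fr w chi.
have := possemidefmx_congr (block_mx (compressor chi) 0 0 1%:M) Psi_ge0.
rewrite Psi_compress.
set A := \matrix_(k, l) _; set B := \matrix_(k, a) _; set B' := \matrix_(a, k) _.
have -> : B' = B^T by apply/matrixP => a k; rewrite !mxE.
move=> S_psd.
have := ip_quad_ge0
  (fun a => match fintype.split a with inl k => Pi i k | inr b => fr i b end)
  S_psd.
rewrite ip_quad_block.
have diag_le : ip_quad A (Pi i) <= (chi^T *m (\sum_k rho k *: Z k k) *m chi) 0 0.
  rewrite mulmx_sumr mulmx_suml summxE /ip_quad; apply: ler_sum => k _.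
  rewrite (bigD1 k) //= big1 ?addr0 => [|l lk]; last first.
    by rewrite (proj2 (Pi_orth i)) ?mulr0 // eq_sym.
  rewrite -scalemxAr -scalemxAl [leRHS]mxE [in leLHS]mxE mulrC -ipnorm_sqr.
  rewrite ler_wpM2r //.
  (* The factor of [rho k] is a diagonal entry of the compressed matrix; its sign makes the bound by
     [rho k] go the right way. *)
  have := possemidefmx_diag (lshift n k) S_psd.
  by rewrite block_mxEul mxE.
have cross : \sum_k \sum_b B k b * ip (E i) (Pi i k) (fr i b) =
    (chi^T *m Nmx N i *m w) 0 0.
  (* The zero columns of [Nmx N i] annihilate the half of [w] that comes from the other piece. *)
  have wE : Nmx N i *m w = \sum_k N k *m ip_col (fr i) (Pi i k).
    by rewrite /w; clear; case: i N => N; rewrite /= mul_row_col mul0mx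
      ?addr0 ?add0r mul_mxrow_mxcol.
  rewrite -mulmxA wE mulmx_sumr summxE; apply: eq_bigr => k _.
  by rewrite mulmxA [RHS]mxE; apply: eq_bigr => b _;
    rewrite [B k b]mxE [ip_col _ _ _ _]mxE ip_sym.
rewrite cross He11 => total_ge0.
(* With all terms on one side, the goal differs from [total_ge0] only in the first summand, where
   [diag_le] applies. *)
rewrite -opprD lerNl -subr_ge0 opprK; apply: le_trans total_ge0 _.
by rewrite !lerD2r.
Qed.
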